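(* For every $\sigma\in S_n$, $$\frac{2^{n-1}}{n^n}\le p_n(\mathrm{id},\sigma)\le\frac{\binom{2n}{n}}{(n+1)n^n}.$$ The right-hand inequality is an equality if and only if $\sigma$ possesses the increasing subsequence $\{1,\dots,n-1\}$ (i.e. cards $1,2,\dots,n-1$ appear in this order from left to right), and the left-hand inequality is an equality if and only if $\sigma$ possesses the decreasing subsequence $\{n-1,\dots,1\}$ (i.e. cards $n-1,n-2,\dots,1$ appear in this order from left to right).
   Context: A permutation $\sigma\in S_n$ is viewed as a deck of cards numbered $1,\dots,n$ laid out in a row, where $\sigma_j$ is the number of the card in the $j$-th position from the left. The card-cyclic to random insertion shuffle removes each of the $n$ cards exactly once and immediately reinserts it in a position chosen uniformly from the $n$ possible positions (independently of the other insertions); the removals and reinsertions are performed one card at a time in the original left-to-right order of the cards. Starting from the identity $\mathrm{id}$ (cards in increasing order from left to right), the cards are thus removed and reinserted in the order $1,2,\dots,n$, and after card $j$ is reinserted in ''position $k$'' it is the $k$-th card from the left. $p_n(\mathrm{id},\sigma)$ denotes the probability that the deck is in state $\sigma$ after one such shuffle started from $\mathrm{id}$. *)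

(* Defs.v *)
From mathcomp Require Import all_boot all_order all_algebra perm.

Set Implicit Arguments.
Unset Strict Implicit.
Unset Printing Implicit Defensive.

Import GRing.Theory Num.Theory.
Local Open Scope ring_scope.

(* Counting from 0: the ordinal j stands for the card numbered j + 1, and s j *)
(* is the card in position j + 1 from the left.                               *)
Definition deck (n : nat) (s : 'S_n) : seq 'I_n := [seq s j | j <- enum 'I_n].

(* Afterwards c has exactly k cards to its left, for k < size s and c \in s. *)
Definition reinsert (T : eqType) (s : seq T) (c : T) (k : nat) : seq T :=
  take k (rem c s) ++ c :: drop k (rem c s).

(* The cards are moved in the left-to-right order of the initial deck s; the *)
(* card initially at place j is reinserted at place k j.                     *)
Definition shuffle (n : nat) (s : 'S_n) (k : {ffun 'I_n -> 'I_n}) : seq 'I_n :=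
  foldl (fun t j => reinsert t (s j) (k j)) (deck s) (enum 'I_n).

(* The joint law of the n independent uniform insertion places gives each *)
(* k : {ffun 'I_n -> 'I_n} the mass \prod_(j < n) n^-1.                   *)
Definition shuffle_prob (R : realFieldType) (n : nat) (s t : 'S_n) : R :=
  \sum_(k : {ffun 'I_n -> 'I_n} | shuffle s k == deck t)
    \prod_(j < n) n%:R^-1.

(* The cards 1, ..., n - 1 in the numbering from 1. *)
Definition all_but_last_card (n : nat) : seq 'I_n :=
  [seq i : 'I_n <- enum 'I_n | (i < n.-1)%N].

(* Main.v *)
(** While card [c] is being moved, the cards not yet moved are still in
    increasing order, so its insertion is described by the last of them that
    it is put behind: call it [a c], with [a c = c] when there is none.  The
    insertions leading from the identity to a fixed [s] correspond to the maps
    [a] such that [c <= a c] and, whenever [x] is left of [y] in [s],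
    [a x = x] or [a x <= a y].  Reading [a] along [s] and remembering only the
    maximum [L] of the values [a x <> x] met so far, each card [c] either keeps
    [L], in exactly one way, or raises it to some [v > max L c].  Hence the
    number of shuffles is obtained by composing, in the order of [s], the
    operators [f |-> (L |-> f L + \sum_(v > max L c) f v)].  Replacing adjacent
    factors [d, c] with [c < d] by [c, d] strictly increases the result, and
    the last card acts trivially; so the maximum is attained exactly when the
    other cards are increasing and the minimum exactly when they are
    decreasing.  There the recursion is solved by ballot numbers and by sums of
    binomials. *)
Require Import Defs.
From mathcomp Require Import all_boot all_order all_algebra perm zify.

Set Implicit Arguments.
Unset Strict Implicit.
Unset Printing Implicit Defensive.

Import GRing.Theory Num.Theory.

(* [w] lists the cards still to be read and [L] is the current maximum; cards
   and values lie below [n]. *)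
Fixpoint jumps (n : nat) (w : seq nat) (L : nat) : nat :=
  if w is c :: w' then
    jumps n w' L + \sum_((maxn L c).+1 <= v < n) jumps n w' v
  else 1.

(** * Effect of an adjacent transposition on the count *)

Lemma jumps_gt0 n w L : 0 < jumps n w L.
Proof. by elim: w => //= c w IHw; rewrite addn_gt0 IHw. Qed.

Lemma jumps_max n w L : n <= L.+1 -> jumps n w L = 1.
Proof.
move=> leL; elim: w => //= c w ->.
by rewrite big_geq // (leq_trans leL) // ltnS leq_maxl.
Qed.

(** A card [c >= n] leaves no [v] with [c < v < n.+1], so its operator is the identity. *)
Lemma jumps_filter n w L :
  jumps n.+1 [seq c <- w | c < n] L = jumps n.+1 w L.
Proof.
elim: w L => //= c w IHw L; case: ltnP => [ltcn | lenc] /=; rewrite !IHw.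
  by congr (_ + _); apply: eq_bigr.
by rewrite big_geq ?addn0 // ltnS (leq_trans lenc) ?leq_maxr.
Qed.

(** After expansion only the double sums differ. For [x > maxn L d] their inner bounds [maxn x c]
    and [maxn x d] agree, so just the [x] with [maxn L c < x <= maxn L d] survive. *)
Lemma jumps_transpose n w c d L : c < d ->
  jumps n (c :: d :: w) L =
  jumps n (d :: c :: w) L + \sum_((maxn L c).+1 <= x < (minn (maxn L d).+1 n))
                              \sum_((maxn x d).+1 <= v < n) jumps n w v.
Proof.
move=> ltcd /=; rewrite !big_split /= addnACA -!addnA.
congr (_ + (_ + (_ + _))).
pose S x := \sum_((maxn x d).+1 <= v < n) jumps n w v.
have -> : \sum_((maxn L d).+1 <= x < n) \sum_((maxn x c).+1 <= v < n) jumps n w v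
          = \sum_((maxn L d).+1 <= x < n) S x.
  apply: eq_big_nat => x /andP[ltx _]; rewrite /S.
  by have -> : maxn x c = maxn x d by lia.
rewrite -/(S _); have [led | gtd] := leqP (maxn L d).+1 n; last first.
  by rewrite [X in _ = X + _]big_geq // ltnW.
rewrite addnC -big_cat_nat //.
by rewrite ltnS geq_max leq_maxl leq_max (ltnW ltcd) orbT.
Qed.

Lemma jumps_transpose_le n u w c d L : c < d ->
  jumps n (u ++ d :: c :: w) L <= jumps n (u ++ c :: d :: w) L.
Proof.
move=> ltcd; elim: u L => [|b u IHu] L.
  by rewrite (jumps_transpose _ _ _ ltcd) leq_addr.
by rewrite /= leq_add // leq_sum.
Qed.

Lemma jumps_transpose_lt n u w c d : c < d -> d < n ->
  jumps n.+1 (u ++ d :: c :: w) 0 < jumps n.+1 (u ++ c :: d :: w) 0.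
Proof.
move=> ltcd ltdn; elim: u => [|b u IHu].
  rewrite (jumps_transpose _ _ _ ltcd) -[ltnLHS]addn0 ltn_add2l.
  (* The term [x = d] is positive: its inner sum runs over [d < v < n.+1] and contains [v = n]. *)
  rewrite (bigD1_seq d) ?mem_index_iota ?iota_uniq //=; last lia.
  by rewrite maxnn big_nat_recr //= -addnA addn_gt0 addn_gt0 jumps_gt0 orbT.
rewrite /= -addSn leq_add // leq_sum // => v _.
exact: jumps_transpose_le.
Qed.

(** * Closed forms for the decreasing and the increasing order *)

Lemma jumps_step n c w L : c <= L -> L.+1 < n ->
  jumps n (c :: w) L = jumps n w L + jumps n (c :: w) L.+1.
Proof.
move=> lecL ltLn /=; congr (_ + _).
by rewrite (maxn_idPl lecL) (maxn_idPl (leqW lecL)) big_ltn.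
Qed.

Lemma jumps_binomial n w L : all (leq^~ L) w -> L <= n ->
  jumps n.+1 w L = 'C(n - L + size w, size w).
Proof.
(* Double induction: on the number [k = n - L] of values above [L], then on [w]. *)
move=> + leLn; move: (subKn leLn); move: (n - L) (leq_subr L n) => k lekn <-.
move: k w lekn; elim=> [|k IHk].
  by move=> w _ _; rewrite jumps_max ?subn0 // add0n binn.
elim=> [|c w IHw] lekn /=; first by rewrite bin0.
case/andP=> lec lew; rewrite -/(jumps _ (c :: w) _) jumps_step //; last lia.
have -> : (n - k.+1).+1 = n - k by lia.
rewrite IHw // IHk; last 2 first.
- exact: ltnW.
- rewrite /= (leq_trans lec) ?leq_sub2l //=.
  by apply: sub_all lew => x /leq_trans; apply; rewrite leq_sub2l.
by rewrite [size (c :: w)]/= -addSnnS [in RHS]addnS binS [LHS]addnC.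
Qed.

Lemma jumps_decreasing n m : m <= n ->
  jumps n.+1 (rev (iota 0 m)) 0 = \sum_(i < m.+1) 'C(n, i).
Proof.
elim: m => [|m IHm] lemn; first by rewrite big_ord1 bin0.
rewrite -{1}(addn1 m) iotaD rev_cat /= IHm; last exact: ltnW.
rewrite [RHS]big_ord_recr /= max0n; congr (_ + _).
set w := rev (iota 0 m).
have lew : all (leq^~ m) w.
  by apply/allP => x; rewrite mem_rev mem_iota => /andP[_ /ltnW].
have szw : size w = m by rewrite size_rev size_iota.
(* Comparing the binomial values of [m :: w] and [w] at [L = m] isolates the sum over [v > m], which
   is ['C(n, m.+1)]. *)
have /= := @jumps_binomial n (m :: w) m; rewrite leqnn lew maxnn szw => /(_ isT).
rewrite jumps_binomial ?(ltnW lemn) // szw => /(_ isT).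
by rewrite addnS subnK ?(ltnW lemn) // binS addnC => /addIn.
Qed.

Lemma jumps_rev_iota n : jumps n.+1 (rev (iota 0 n)) 0 = 2 ^ n.
Proof.
rewrite jumps_decreasing // (expnDn 1 1); apply: eq_bigr => i _.
by rewrite !exp1n !muln1.
Qed.

Lemma jumps_iota_const n m r L : L <= m ->
  jumps n (iota m r) L = jumps n (iota m r) m.
Proof.
elim: r m L => //= r IHr m L leLm.
rewrite (maxn_idPr leLm) maxnn; congr (_ + _).
by rewrite (IHr _ L) ?(IHr _ m) ?leqW.
Qed.

(* The difference of the two binomials is a ballot number; it obeys the same
   Pascal rule as [jumps_step]. *)
Lemma jumps_iota_ballot m r k : k <= r ->
  jumps (m + r).+1 (iota m r) (m + r - k) + 'C((r + k).+1, r.+2) =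
  'C((r + k).+1, r.+1).
Proof.
elim: r m k => [|r IHr] m k.
  by case: k => // _; rewrite /= bin_small ?binn.
have {}IHr j : j <= r.+1 ->
    jumps (m + r.+1).+1 (iota m.+1 r) (m + r.+1 - j) + 'C((r + j).+1, r.+2) =
    'C((r + j).+1, r.+1).
  (* For j = r + 1 the argument lies below all the cards, so that it can be
     raised by one. *)
  rewrite leq_eqVlt ltnS -addSnnS => /predU1P[-> | /IHr->] //.
  rewrite (jumps_iota_const _ _ (L := _ - _)); last lia.
  have := IHr m.+1 r (leqnn r); rewrite addnK.
  (* By symmetry of this row, the extra Pascal terms on the two sides are equal. *)
  have : 'C((r + r).+1, r) = 'C((r + r).+1, r.+1).
    by rewrite -bin_sub ?subSn ?addnK //; lia.
  by rewrite addnS !(binS (r + r).+1); lia.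
elim: k => [|k IHk] lekr.
  by rewrite jumps_max ?subn0 // addn0 binn bin_small.
have ->: iota m r.+1 = m :: iota m.+1 r by [].
rewrite jumps_step; [|lia|lia].
have -> : (m + r.+1 - k.+1).+1 = m + r.+1 - k by lia.
have := IHr _ lekr; have := IHk (ltnW lekr).
by rewrite !addSn !addnS !(binS (r + k).+2) /=; lia.
Qed.

(** The count is the Catalan number of index [n.+1], obtained from the ballot difference of the
    binomials [2n+1] over [n+1] and over [n+2]. *)
Lemma jumps_iota n : n.+2 * jumps n.+1 (iota 0 n) 0 = 'C(2 * n.+1, n.+1).
Proof.
have := jumps_iota_ballot 0 (leqnn n); rewrite add0n subnn.
have -> : 2 * n.+1 = (n + n).+2 by lia.
have e1 := mul_bin_left (n + n).+1 n.+1.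
have e2 : 'C((n + n).+1, n) = 'C((n + n).+1, n.+1).
  by rewrite -bin_sub ?subSn ?addnK //; lia.
rewrite (binS (n + n).+1) e2.
have e3 : (n + n).+1 - n.+1 = n by lia.
by move: e1; rewrite e3; nia.
Qed.

(** * Extremal orders, reached by successive exchanges *)

Lemma not_sorted_descent (T : eqType) (r : rel T) (w : seq T) :
  ~~ sorted r w -> exists u x y v, w = u ++ x :: y :: v /\ ~~ r x y.
Proof.
case: w => //= x w; elim: w x => //= y w IHw x; rewrite negb_and.
case/orP=> [nrxy | /IHw[u [x' [y' [v [-> nr]]]]]]; first by exists [::], x, y, w.
by exists (x :: u), x', y', v.
Qed.

(** Swapping a descent strictly improves [G]. This terminates because fewer and fewer rearrangements
    of [s] have a better value of [G]. *)
Lemma sorted_extremal (T U : eqType) (r : rel T) (lt : rel U)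
    (G : seq T -> U) (s : seq T) :
  transitive r -> antisymmetric r -> irreflexive lt -> transitive lt ->
  sorted r s ->
  (forall u x y v, perm_eq (u ++ x :: y :: v) s -> ~~ r x y ->
     lt (G (u ++ x :: y :: v)) (G (u ++ y :: x :: v))) ->
  forall w, perm_eq w s -> w = s \/ lt (G w) (G s).
Proof.
move=> tr_r anti_r irr_lt tr_lt sorted_s swap w.
have [m] := ubnP (count (fun v => lt (G w) (G v)) (permutations s)).
elim: m w => // m IHm w; rewrite ltnS => le_m perm_w.
have [sorted_w | /not_sorted_descent] := boolP (sorted r w).
  by left; apply: (sorted_eq tr_r anti_r).
case=> u [x [y [v [def_w nr_xy]]]]; set w' := u ++ y :: x :: v.
have perm_w' : perm_eq w' s.
  rewrite -(permPr perm_w) def_w perm_cat2l.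
  by rewrite (perm_catCA [:: y] [:: x] v).
have lt_ww' : lt (G w) (G w') by rewrite def_w swap -?def_w.
suff [<- | lt_w's] : w' = s \/ lt (G w') (G s); [by right|by right; apply: tr_lt lt_w's|].
apply: IHm => //; apply: leq_trans le_m.
have /perm_to_rem perm_rem : w' \in permutations s by rewrite mem_permutations.
rewrite !(seq.permP perm_rem) /= irr_lt lt_ww' add0n ltnS.
by apply: sub_count => z; apply: tr_lt.
Qed.

Lemma jumps_max_iota n w : perm_eq w (iota 0 n) ->
  w = iota 0 n \/ jumps n.+1 w 0 < jumps n.+1 (iota 0 n) 0.
Proof.
apply: (sorted_extremal (r := leq) (lt := ltn) (G := fun w => jumps n.+1 w 0)).
- exact: leq_trans.
- exact: anti_leq.
- exact: ltnn.
- exact: ltn_trans.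
- exact: iota_sorted.
move=> u x y v perm_w; rewrite -ltnNge => ltyx; apply: jumps_transpose_lt => //.
have : x \in iota 0 n by rewrite -(perm_mem perm_w) mem_cat mem_head orbT.
by rewrite mem_iota.
Qed.

Lemma jumps_min_rev_iota n w : perm_eq w (iota 0 n) ->
  w = rev (iota 0 n) \/ jumps n.+1 (rev (iota 0 n)) 0 < jumps n.+1 w 0.
Proof.
rewrite -(permPr (_ : perm_eq (rev (iota 0 n)) _)) ?perm_rev // => perm_w.
apply: (sorted_extremal (r := geq) (lt := gtn) (G := fun w => jumps n.+1 w 0)).
- by move=> y x z /= leyx lezy; apply: leq_trans leyx.
- by move=> x y /=; rewrite andbC; apply: anti_leq.
- exact: ltnn.
- by move=> y x z /= ltyx ltzy; apply: ltn_trans ltyx.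
- by rewrite rev_sorted iota_sorted.
- move=> u x y v perm_uv; rewrite -ltnNge => ltxy; apply: jumps_transpose_lt => //.
  have : y \in rev (iota 0 n) by rewrite -(perm_mem perm_uv) mem_cat !inE eqxx !orbT.
  by rewrite mem_rev mem_iota.
- exact: perm_w.
Qed.

(** * Counting admissible maps *)

Section Fillings.
Variable n : nat.
Implicit Types (w : seq 'I_n) (a : 'I_n -> 'I_n).

(* The value sequences [map a w] of the admissible [a] with values at least
   [L]; see [mem_fillings]. *)
Fixpoint fillings w (L : nat) : seq (seq 'I_n) :=
  if w is c :: w' then
    [seq v :: b | v <- [seq v : 'I_n <- enum 'I_n | maxn L c <= v],
                  b <- fillings w' (if v == c then L else v)]
  else [:: [::]].

Lemma size_fillings w L : L < n -> size (fillings w L) = jumps n (map val w) L.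
Proof.
elim: w L => //= c w IHw L ltLn.
have lt_max : maxn L c < n by rewrite gtn_max ltLn ltn_ord.
rewrite size_allpairs_dep sumnE big_map big_filter /=.
(* The choice [v = maxn L c] is the one that keeps [L]: it is [c] if [L <= c], and [L] itself
   otherwise. *)
rewrite big_enum_cond (bigD1 (Ordinal lt_max)) ?leqnn //=; congr (_ + _).
  rewrite -IHw //; congr (size (fillings _ _)).
  by rewrite -val_eqE /=; case: eqP => //; lia.
rewrite big_geq_mkord /=; apply: eq_big => [v | v /andP[le_v]].
  by rewrite ltn_neqAle andbC -val_eqE /= eq_sym.
rewrite -val_eqE /= => neq_v; rewrite IHw; last by case: ifP.
have -> // : (v == c) = false.
by rewrite -val_eqE /=; apply/eqP; lia.
Qed.

Definition admissible a : rel 'I_n := fun x y => (a x == x) || (a x <= a y).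

Lemma mem_fillings a w L :
  (map a w \in fillings w L) =
  [&& all (fun c : 'I_n => c <= a c) w, all (fun c => L <= a c) w
    & pairwise (admissible a) w].
Proof.
elim: w L => [|c w IHw] L; first by rewrite inE eqxx.
have -> : (map a (c :: w) \in fillings (c :: w) L) =
    (maxn L c <= a c) && (map a w \in fillings w (if a c == c then L else a c)).
  apply/allpairsPdep/andP => [[v [b []]] | [le_max in_w]].
    by rewrite mem_filter => /andP[le_v _] b_in [-> ->].
  by exists (a c), (map a w); rewrite mem_filter le_max mem_enum.
rewrite IHw geq_max /= /admissible.
case: (L <= a c) / boolP => leL; last by rewrite !andbF.
case: eqP => [_ | _] /=.
  by rewrite all_predT /= !andbA.
(* Since [L <= a c], the bound [a c] on the later values implies the bound [L]. *)
rewrite -!andbA; do 2!congr (_ && _).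
rewrite andbA; congr (_ && _); apply/idP/andP => [le_w | [] //]; split=> //.
by apply: sub_all le_w => x; apply: leq_trans.
Qed.

Lemma size_mem_fillings w L b : b \in fillings w L -> size b = size w.
Proof.
elim: w L b => [|c w IHw] L b /=; first by rewrite inE => /eqP->.
by case/allpairsPdep => v [b' [_ /IHw <- ->]].
Qed.

Lemma uniq_fillings w L : uniq (fillings w L).
Proof.
elim: w L => //= c w IHw L; apply: allpairs_uniq_dep.
- by rewrite filter_uniq ?enum_uniq.
- by move=> v _; apply: IHw.
- move=> [v b] [v' b'] _ _ /= [-> ->] //.
Qed.

End Fillings.

Lemma card_admissible n (s : 'S_n) : 0 < n ->
  #|[set a : {ffun 'I_n -> 'I_n} | [forall c : 'I_n, c <= a c] &&
       pairwise (admissible a) (deck s)]| =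
  jumps n (map val (deck s)) 0.
Proof.
move=> n_gt0; rewrite -size_fillings //; set A := [set a | _].
rewrite cardE -(size_map (fun a : {ffun _} => map a (deck s))).
apply/perm_size/uniq_perm; rewrite ?uniq_fillings //.
  rewrite map_inj_in_uniq ?enum_uniq // => a b _ _ /eq_in_map eq_ab.
  apply/ffunP => x; apply: eq_ab.
  by rewrite -[x](permKV s) map_f ?mem_enum.
move=> b; apply/mapP/idP => [[a + ->] | b_in].
  rewrite mem_enum inE mem_fillings => /andP[/forallP le_a ->].
  by rewrite andbT; apply/andP; split; apply/allP.
have size_deck : size (deck s) = n by rewrite size_map size_enum_ord.
have size_b : size b = n by rewrite (size_mem_fillings b_in).
(* The value at [c] is read in [b] at the position of [c] in the deck. *)
pose a := [ffun c => nth c b ((s^-1)%g c)].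
have def_b : b = map a (deck s).
  apply: (@eq_from_nth _ (Ordinal n_gt0)); first by rewrite size_map size_deck.
  move=> i; rewrite size_b => lt_i; pose j := Ordinal lt_i.
  rewrite -map_comp (nth_map j) ?size_enum_ord // (nth_ord_enum j j) /= ffunE permK.
  by apply: set_nth_default; rewrite size_b.
exists a => //; move: b_in; rewrite def_b mem_fillings mem_enum inE.
case/and3P => /allP le_a _ ->; rewrite andbT; apply/forallP => x; apply: le_a.
by rewrite -[x](permKV s) map_f ?mem_enum.
Qed.

(** * Reinsertion and the relative order of two cards *)

Section Reinsert.
Variable T : eqType.
Implicit Types (t : seq T) (c x y z : T).

Lemma perm_reinsert t c k : c \in t -> perm_eq (reinsert t c k) t.
Proof.
move=> c_t; rewrite (permPr (perm_to_rem c_t)) /reinsert.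
by rewrite perm_catC /= perm_cons perm_catC cat_take_drop.
Qed.

Lemma rem_reinsert t c k : uniq t -> rem c (reinsert t c k) = rem c t.
Proof.
move=> uniq_t; have c_notin : c \notin rem c t by rewrite mem_rem_uniq ?inE ?eqxx.
rewrite /reinsert; move: c_notin; move: (rem c t) => u c_notin.
rewrite -[RHS](cat_take_drop k) remE.
have c_take : c \notin take k u by apply: contra c_notin; apply: mem_take.
rewrite index_cat (negPf c_take) /= eqxx addn0 take_size_cat //.
by rewrite drop_cat ltnNge leqnSn /= subSnn /= drop0.
Qed.

Lemma reinsert_index t t' c :
  c \in t -> rem c t' = rem c t -> reinsert t' c (index c t) = t.
Proof.
move=> c_t eq_rem; rewrite /reinsert eq_rem remE.
have le_ind : index c t <= size t by rewrite index_size.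
rewrite take_size_cat ?size_takel // drop_size_cat ?size_takel //.
rewrite -[RHS](cat_take_drop (index c t)); congr (_ ++ _).
by rewrite [RHS](drop_nth c) ?index_mem // nth_index.
Qed.

Lemma index_reinsert t c k :
  uniq t -> c \in t -> k < size t -> index c (reinsert t c k) = k.
Proof.
move=> uniq_t c_t lt_k; rewrite /reinsert index_cat.
have c_notin : c \notin rem c t by rewrite mem_rem_uniq ?inE ?eqxx.
have c_take : c \notin take k (rem c t) by apply: contra c_notin; apply: mem_take.
rewrite (negPf c_take) /= eqxx addn0 size_takel // size_rem //; lia.
Qed.

(** From here on [subseq [:: x; y]] expresses that [x] lies left of [y]. *)
Lemma subseq2E t x y : uniq t ->
  subseq [:: x; y] t = (y \in t) && (index x t < index y t).
Proof.
elim: t => //= z t IHt /andP[z_t uniq_t]; rewrite inE.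
have [_ | neq_xz] := eqVneq x z; last first.
  rewrite IHt //; case: eqVneq => [-> | _] //=.
  by rewrite (negPf z_t) ltn0.
by rewrite sub1seq; case: eqVneq => [-> | _] /=; rewrite ?(negPf z_t) ?andbT.
Qed.

Lemma subseq2_total t x y : uniq t -> x \in t -> y \in t -> x != y ->
  subseq [:: y; x] t = ~~ subseq [:: x; y] t.
Proof.
move=> uniq_t x_t y_t neq; rewrite !subseq2E // x_t y_t /= -leqNgt ltn_neqAle.
suff -> : (index y t != index x t) by [].
by apply: contra neq => /eqP eq_i; rewrite -(nth_index x y_t) eq_i nth_index.
Qed.

Lemma subseq2_trans t x y z : uniq t ->
  subseq [:: x; y] t -> subseq [:: y; z] t -> subseq [:: x; z] t.
Proof.
move=> uniq_t; rewrite !subseq2E // => /andP[_ ltxy] /andP[-> ltyz].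
exact: ltn_trans ltyz.
Qed.

Lemma subseq2_reinsert t c k x y : uniq t -> c \in t -> x != c -> y != c ->
  subseq [:: x; y] (reinsert t c k) = subseq [:: x; y] t.
Proof.
move=> uniq_t c_t neq_x neq_y.
have uniq_r : uniq (reinsert t c k) by rewrite (perm_uniq (perm_reinsert _ c_t)).
transitivity (subseq [:: x; y] (rem c t)).
  by rewrite -(rem_reinsert c k) // rem_filter // subseq_filter /= neq_x neq_y.
by rewrite rem_filter // subseq_filter /= neq_x neq_y.
Qed.

Lemma subseq2_pairwise (r : rel T) t :
  (forall x y, subseq [:: x; y] t -> r x y) -> pairwise r t.
Proof.
elim: t => //= z t IHt sub_r; apply/andP; split.
  by apply/allP => y y_t; apply: sub_r; rewrite eqxx sub1seq.
apply: IHt => x y sub_t; apply: sub_r; case: ifP => // _.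
by apply: subseq_trans sub_t; apply: (suffix_subseq [:: x]).
Qed.

End Reinsert.

(** * Bijection between shuffles and admissible maps *)

Section Shuffles.
Variables (n : nat) (s : 'S_n).
Implicit Types (k : {ffun 'I_n -> 'I_n}) (c x y z : 'I_n).

Definition deck_after k j : seq 'I_n :=
  foldl (fun t c => reinsert t c (k c)) (enum 'I_n) (take j (enum 'I_n)).

Lemma deck_after0 k : deck_after k 0 = enum 'I_n.
Proof. by rewrite /deck_after take0. Qed.

Lemma deck_afterS k c :
  deck_after k c.+1 = reinsert (deck_after k c) c (k c).
Proof.
by rewrite /deck_after (take_nth c) ?size_enum_ord // foldl_rcons nth_ord_enum.
Qed.

Lemma shuffle1E k : shuffle 1%g k = deck_after k n.
Proof.
rewrite /shuffle /deck_after take_oversize ?size_enum_ord //.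
have -> : deck (1%g : 'S_n) = enum 'I_n.
  by rewrite -[RHS]map_id; apply: eq_map => x; rewrite perm1.
suff foldlE w t : foldl (fun t c => reinsert t ((1%g : 'S_n) c) (k c)) t w =
    foldl (fun t c => reinsert t c (k c)) t w by apply: foldlE.
by elim: w t => //= c w IHw t; rewrite perm1.
Qed.

Lemma perm_deck_after k j : j <= n -> perm_eq (deck_after k j) (enum 'I_n).
Proof.
elim: j => [|j IHj] ltj; first by rewrite deck_after0.
have perm_j := IHj (ltnW ltj).
rewrite (deck_afterS k (Ordinal ltj)) -(permPr perm_j) perm_reinsert //.
by rewrite (perm_mem perm_j) mem_enum.
Qed.

Lemma uniq_deck_after k j : j <= n -> uniq (deck_after k j).
Proof. by move/(perm_deck_after k)/perm_uniq->; rewrite enum_uniq. Qed.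

Lemma mem_deck_after k j x : j <= n -> x \in deck_after k j.
Proof. by move/(perm_deck_after k)/perm_mem->; rewrite mem_enum. Qed.

(** Neither card moves between the stages [i] and [j]. *)
Lemma subseq2_deck_after k i j x y : i <= j <= n ->
    (x < i) || (j <= x) -> (y < i) || (j <= y) ->
  subseq [:: x; y] (deck_after k j) = subseq [:: x; y] (deck_after k i).
Proof.
case/andP=> leij; rewrite -(subnK leij) addnC; move: (j - i) => d.
elim: d => [|d IHd]; first by rewrite addn0.
rewrite addnS => lt_n out_x out_y; have lt_c : i + d < n by [].
rewrite (deck_afterS k (Ordinal lt_c)) subseq2_reinsert.
- by apply: IHd; lia.
- by rewrite uniq_deck_after // ltnW.
- by rewrite mem_deck_after // ltnW.
- by rewrite -val_eqE /=; lia.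
- by rewrite -val_eqE /=; lia.
Qed.

Lemma subseq2_enum x y : subseq [:: x; y] (enum 'I_n) = (x < y).
Proof. by rewrite subseq2E ?enum_uniq // mem_enum !index_enum_ord. Qed.

Lemma uniq_deck : uniq (deck s).
Proof. by rewrite map_inj_uniq ?enum_uniq //; apply: perm_inj. Qed.

Lemma mem_deck x : x \in deck s.
Proof. by rewrite -[x](permKV s) map_f ?mem_enum. Qed.

Lemma subseq2_deck x y :
  subseq [:: x; y] (deck s) = ((s^-1)%g x < (s^-1)%g y).
Proof.
have index_deck z : index z (deck s) = (s^-1)%g z.
  by rewrite -{1}[z](permKV s) index_map ?index_enum_ord //; apply: perm_inj.
by rewrite subseq2E ?uniq_deck // !index_deck mem_deck.
Qed.

(** The map [a] of the shuffle [k]; the alternative [y == c] gives its value when [c] is put before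
    all unmoved cards. *)
Definition last_passed k : {ffun 'I_n -> 'I_n} :=
  [ffun c : 'I_n => [arg max_(y > c |
     (y == c) || (c < y) && subseq [:: y; c] (deck_after k c.+1)) val y]].

Lemma last_passed_ge k c : c <= last_passed k c.
Proof.
rewrite ffunE; case: arg_maxnP => [|y]; rewrite ?eqxx //.
by case/predU1P=> [-> | /andP[/ltnW]].
Qed.

(** The unmoved cards are still increasing, so those left of [c] are exactly the ones up to the
    largest of them. *)
Lemma le_last_passed k c y : c < y ->
  (y <= last_passed k c) = subseq [:: y; c] (deck_after k c.+1).
Proof.
move=> ltcy; rewrite ffunE; case: arg_maxnP => [|z]; first by rewrite eqxx.
move=> Pz max_z; apply/idP/idP => [leyz | ?]; last first.
  by apply: max_z; apply/orP; right; apply/andP.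
have ltcz := leq_trans ltcy leyz.
have /andP[_ bef_z] : (c < z) && subseq [:: z; c] (deck_after k c.+1).
  by case/predU1P: Pz => // eq_zc; rewrite eq_zc ltnn in ltcz.
have [-> // | neq] := eqVneq y z.
apply: subseq2_trans bef_z; first exact: uniq_deck_after.
rewrite (@subseq2_deck_after _ 0) //=.
by rewrite deck_after0 subseq2_enum ltn_neqAle neq.
Qed.

Definition filling (a : 'I_n -> 'I_n) : bool :=
  [forall c : 'I_n, c <= a c] && pairwise (admissible a) (deck s).

Lemma fillingP (a : 'I_n -> 'I_n) :
  reflect ((forall c, c <= a c) /\
           forall x y, (s^-1)%g x < (s^-1)%g y -> admissible a x y)
          (filling a).
Proof.
apply: (iffP andP) => [[/forallP le_a adm_a] | [le_a adm_a]]; split=> //.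
- move=> x y; rewrite -subseq2_deck => sub_xy.
  by have /= := subseq_pairwise sub_xy adm_a; rewrite !andbT.
- exact/forallP.
- by apply: subseq2_pairwise => x y; rewrite subseq2_deck; apply: adm_a.
Qed.

Lemma filling_last_passed k : deck_after k n = deck s -> filling (last_passed k).
Proof.
move=> final; apply/fillingP; split=> [|x y]; first exact: last_passed_ge.
rewrite -subseq2_deck -final => lt_xy; rewrite /admissible.
have [// | neq /=] := eqVneq; set z := last_passed k x.
have ltxz : x < z by rewrite ltn_neqAle last_passed_ge eq_sym neq.
have [lezy | ltyz] := leqP z y; first exact: leq_trans (last_passed_ge k y).
have zx : subseq [:: z; x] (deck_after k x.+1) by rewrite -le_last_passed.
(* At stage [m] both [x] and [y] have been moved, while [z] has not. There [z] is left of [x] and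
   [x] left of [y], so [y] has passed [z] too. *)
pose m := maxn x.+1 y.+1.
have lemn : m <= n by rewrite geq_max !ltn_ord.
rewrite le_last_passed //.
rewrite -(@subseq2_deck_after _ _ m) //; [|lia|lia|lia].
apply: (@subseq2_trans _ _ _ x); first exact: uniq_deck_after.
  by rewrite (@subseq2_deck_after _ x.+1) //; lia.
by rewrite -(@subseq2_deck_after _ _ n) //; lia.
Qed.

(* The order of the deck described by [a] when the cards below [j], and only
   these, have been moved. *)
Definition precedes (a : 'I_n -> 'I_n) (j : nat) : rel 'I_n := fun x y =>
  if x < j then if y < j then (s^-1)%g x <= (s^-1)%g y else a x < y
  else if y < j then x <= a y else x <= y.

Lemma precedes_total a j : total (precedes a j).
Proof. by move=> x y; rewrite /precedes; do 2!case: ltnP => _; lia. Qed.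

Lemma precedes_anti a j : antisymmetric (precedes a j).
Proof.
move=> x y; rewrite /precedes; do 2!case: ltnP => _.
- by move/anti_leq/val_inj/perm_inj.
- by lia.
- by lia.
- by move/anti_leq/val_inj.
Qed.

(** Admissibility serves in the cases of two moved cards and one unmoved card: it puts the unmoved
    card on compatible sides of the two. *)
Lemma precedes_trans a j : filling a -> transitive (precedes a j).
Proof.
case/fillingP=> le_a adm_a y x z.
have le_pos u v : (s^-1)%g u <= (s^-1)%g v -> u = v \/ admissible a u v.
  rewrite leq_eqVlt => /predU1P[/val_inj/perm_inj | /adm_a]; by [left|right].
rewrite /precedes; case: (ltnP x j) => ltx; case: (ltnP y j) => lty;
  case: (ltnP z j) => ltz; try lia.
- by move=> /le_pos[-> // | /orP[/eqP-> | ]]; lia.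
- move=> lt_x le_z; rewrite leqNgt; apply/negP => /adm_a.
  by case/orP => [/eqP eq_z | ]; first rewrite eq_z in le_z; lia.
- by move=> le_y /le_pos[<- // | /orP[/eqP eq_y | ]]; first rewrite eq_y in le_y; lia.
Qed.

Definition arrangement a j : seq 'I_n := sort (precedes a j) (enum 'I_n).

Lemma perm_arrangement a j : perm_eq (arrangement a j) (enum 'I_n).
Proof. by rewrite perm_sort. Qed.

Lemma sorted_arrangement a j w : filling a ->
  perm_eq w (enum 'I_n) -> sorted (precedes a j) w -> w = arrangement a j.
Proof.
move=> fill_a perm_w sorted_w.
apply: (sorted_eq (precedes_trans fill_a) (@precedes_anti a j)) => //.
  exact/sort_sorted/precedes_total.
by rewrite (permPl perm_w) perm_sym perm_arrangement.
Qed.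

Lemma subseq2_arrangement a j x y : filling a -> x != y ->
  subseq [:: x; y] (arrangement a j) = precedes a j x y.
Proof.
move=> fill_a neq; have tr := precedes_trans fill_a.
have sorted_a : sorted (precedes a j) (arrangement a j).
  exact/sort_sorted/precedes_total.
have sub_prec u v : subseq [:: u; v] (arrangement a j) -> precedes a j u v.
  by move/(subseq_sorted (tr j))/(_ sorted_a) => /=; rewrite andbT.
apply/idP/idP => [/sub_prec // | prec_xy]; apply: contraT.
rewrite -subseq2_total ?sort_uniq ?enum_uniq ?mem_sort ?mem_enum //.
move/sub_prec => prec_yx; case/eqP: neq; apply: (@precedes_anti a j).
by rewrite prec_xy.
Qed.

(** Two moved cards are compared in the final deck, two unmoved ones in the initial deck, and a
    moved card [c] with an unmoved one at stage [c.+1]. *)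
Lemma deck_after_arrangement k j : deck_after k n = deck s -> j <= n ->
  deck_after k j = arrangement (last_passed k) j.
Proof.
move=> final lejn; apply: sorted_arrangement; first exact: filling_last_passed.
  exact: perm_deck_after.
apply/pairwise_sorted/subseq2_pairwise => x y sub_xy.
rewrite /precedes; case: ltnP => ltx; case: ltnP => lty.
- rewrite ltnW // -subseq2_deck -final.
  by rewrite (@subseq2_deck_after _ j) ?lejn ?leqnn ?ltx ?lty.
- rewrite ltnNge le_last_passed; last lia.
  have neq : y != x by rewrite -val_eqE /=; lia.
  rewrite -subseq2_total ?uniq_deck_after ?mem_deck_after //.
  by rewrite -(@subseq2_deck_after _ _ j) //; lia.
- rewrite le_last_passed; last lia.
  by rewrite -(@subseq2_deck_after _ _ j) //; lia.
- by rewrite ltnW // -subseq2_enum -(deck_after0 k) -(@subseq2_deck_after _ _ j) //; lia.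
Qed.

Lemma arrangement0 a : filling a -> arrangement a 0 = enum 'I_n.
Proof.
move=> fill_a; apply/esym/sorted_arrangement => //.
apply/pairwise_sorted/subseq2_pairwise => x y.
by rewrite subseq2_enum => /ltnW.
Qed.

Lemma arrangement_n a : filling a -> arrangement a n = deck s.
Proof.
move=> fill_a; apply/esym/sorted_arrangement => //.
  apply: uniq_perm; rewrite ?uniq_deck ?enum_uniq // => x.
  by rewrite mem_enum mem_deck.
apply/pairwise_sorted/subseq2_pairwise => x y.
by rewrite subseq2_deck /precedes !ltn_ord => /ltnW.
Qed.

(** The inverse of [last_passed]: each card goes to its place in the next arrangement. That place is
    below [n], so [insubd] merely makes it an ordinal. *)
Definition insertions a : {ffun 'I_n -> 'I_n} :=
  [ffun c : 'I_n => insubd c (index c (arrangement a c.+1))].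

Lemma val_insertions a c : insertions a c = index c (arrangement a c.+1) :> nat.
Proof.
rewrite ffunE val_insubd.
rewrite -[X in _ < X](size_enum_ord n) -(perm_size (perm_arrangement a c.+1)).
by rewrite index_mem (perm_mem (perm_arrangement _ _)) mem_enum.
Qed.

Lemma deck_after_insertions a j : filling a -> j <= n ->
  deck_after (insertions a) j = arrangement a j.
Proof.
move=> fill_a; elim: j => [|j IHj] ltj; first by rewrite deck_after0 arrangement0.
pose c := Ordinal ltj; rewrite (deck_afterS _ c) IHj; last exact: ltnW.
rewrite val_insertions; apply: reinsert_index.
  by rewrite mem_sort mem_enum.
rewrite !rem_filter ?sort_uniq ?enum_uniq //.
(* Without card [j] both sides sort the same cards, and the thresholds [j] and [j.+1] treat every
   other card alike. *)
rewrite !filter_sort; try by [apply: precedes_total | apply: precedes_trans].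
apply: (sorted_eq (precedes_trans fill_a) (@precedes_anti a j)).
- exact/sort_sorted/precedes_total.
- rewrite (eq_in_sorted (P := predC1 c) (e' := precedes a j.+1)).
  + exact/sort_sorted/precedes_total.
  + move=> x y; rewrite !inE -!val_eqE /= => neq_x neq_y; rewrite /precedes.
    have -> : (x < j.+1) = (x < j) by lia.
    by have -> : (y < j.+1) = (y < j) by lia.
  + by rewrite all_sort filter_all.
- by rewrite perm_sort perm_sym perm_sort.
Qed.

Lemma last_passed_insertions a : filling a -> last_passed (insertions a) =1 a.
Proof.
move=> fill_a c; have /fillingP[le_a _] := fill_a.
(* Both values are at least [c], so they are determined by the [y > c] that they bound. *)
have le_eq y : c < y -> (y <= last_passed (insertions a) c) = (y <= a c).
  move=> ltcy; rewrite le_last_passed // deck_after_insertions //.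
  have neq : y != c by rewrite -val_eqE /= gtn_eqF.
  rewrite subseq2_arrangement // /precedes.
  by rewrite ltnS leqNgt ltcy leqnn.
apply/val_inj/eqP; rewrite eqn_leq; apply/andP; split.
  have [-> | neq] := eqVneq (last_passed (insertions a) c) c; first exact: le_a.
  by rewrite -le_eq ?leqnn // ltn_neqAle last_passed_ge eq_sym neq.
have [-> | neq] := eqVneq (a c) c; first exact: last_passed_ge.
by rewrite le_eq // ltn_neqAle le_a eq_sym neq.
Qed.

Lemma insertions_last_passed k :
  deck_after k n = deck s -> insertions (last_passed k) = k.
Proof.
move=> final; apply/ffunP => c; apply/val_inj; rewrite /= val_insertions.
rewrite -deck_after_arrangement // deck_afterS index_reinsert //.
- by rewrite uniq_deck_after // ltnW.
- by rewrite mem_deck_after // ltnW.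
- by rewrite (perm_size (perm_deck_after k _)) ?size_enum_ord // ltnW.
Qed.

Lemma card_shuffles :
  #|[set k | shuffle 1%g k == deck s]| =
  #|[set a : {ffun 'I_n -> 'I_n} | filling a]|.
Proof.
rewrite -(card_in_imset (f := last_passed)) => [|k k'].
  apply: eq_card => a; apply/imsetP/idP => [[k + ->] | ].
    by rewrite !inE shuffle1E => /eqP/filling_last_passed.
  rewrite inE => fill_a; exists (insertions a).
    by rewrite inE shuffle1E deck_after_insertions // arrangement_n.
  by apply/ffunP => c; rewrite last_passed_insertions.
rewrite !inE !shuffle1E => /eqP final /eqP final' eq_last.
by rewrite -[k]insertions_last_passed // eq_last insertions_last_passed.
Qed.

End Shuffles.

(** * From counts to probabilities *)

Lemma map_val_all_but_last_card n :
  map val (all_but_last_card n.+1) = iota 0 n.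
Proof.
rewrite -(filter_map val (fun i => i < n)) val_enum_ord -addn1 iotaD filter_cat /=.
by rewrite ltnn cats0; apply/all_filterP/allP => i; rewrite mem_iota.
Qed.

(** In a duplicate-free deck, a subsequence is the filter of the deck by its own cards. Assuming
    only [=i] covers both the increasing and the decreasing list. *)
Lemma subseq_deckE n (s : 'S_n.+1) (t : seq 'I_n.+1) :
    t =i all_but_last_card n.+1 ->
  subseq t (deck s) <-> [seq c <- map val (deck s) | c < n] = map val t.
Proof.
move=> eq_t; rewrite filter_map.
have -> : [seq c <- deck s | preim val (fun c => c < n) c] =
          [seq c <- deck s | c \in t].
  by apply: eq_filter => c; rewrite eq_t mem_filter mem_enum andbT.
split=> [/(subseq_uniqP (uniq_deck s))<- // | /(inj_map val_inj) eq_f].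
exact/(subseq_uniqP (uniq_deck s)).
Qed.

Local Open Scope ring_scope.

(** All choices of insertion places have equal mass, so only their number matters; the last card is
    then dropped from the count. *)
Lemma shuffle_probE (R : realFieldType) n (s : 'S_n.+1) :
  shuffle_prob R 1%g s =
  (jumps n.+1 [seq c <- map val (deck s) | (c < n)%N] 0)%:R / n.+1%:R ^+ n.+1.
Proof.
rewrite jumps_filter -card_admissible // -card_shuffles /shuffle_prob.
rewrite prodr_const card_ord sumr_const mulr_natl exprVn.
by congr (_ *+ _); apply: eq_card => k; rewrite inE.
Qed.

Theorem corollary7 (R : realFieldType) (n : nat) (n_gt0 : (0 < n)%N)
    (s : 'S_n) :
  let lower : R := 2 ^+ n.-1 / n%:R ^+ n in
  let upper : R := 'C(2 * n, n)%:R / (n.+1%:R * n%:R ^+ n) in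
  let p : R := shuffle_prob R (1%g : 'S_n) s in
  [/\ lower <= p, p <= upper,
      p = upper <-> subseq (all_but_last_card n) (deck s)
    & p = lower <-> subseq (rev (all_but_last_card n)) (deck s)].
Proof.
case: n n_gt0 s => // n _ s lower upper p.
set w := [seq c <- map val (deck s) | (c < n)%N].
have perm_w : perm_eq w (iota 0 n).
  rewrite -map_val_all_but_last_card -(filter_map val (fun i => i < n)%N).
  apply/perm_filter/perm_map/uniq_perm; rewrite ?uniq_deck ?enum_uniq // => x.
  by rewrite mem_deck mem_enum.
have D_gt0 : 0 < (n.+1%:R ^+ n.+1)^-1 :> R by rewrite invr_gt0 exprn_gt0 ?ltr0n.
have D_inj := mulIf (lt0r_neq0 D_gt0).
have def_p : p = (jumps n.+1 w 0)%:R / n.+1%:R ^+ n.+1 by apply: shuffle_probE.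
have def_lower : lower = (jumps n.+1 (rev (iota 0 n)) 0)%:R / n.+1%:R ^+ n.+1.
  by rewrite jumps_rev_iota natrX.
have def_upper : upper = (jumps n.+1 (iota 0 n) 0)%:R / n.+1%:R ^+ n.+1.
  (* The factor [n.+2] multiplying the Catalan number cancels the one in the denominator of
     [upper]. *)
  rewrite /upper -jumps_iota natrM invfM mulrA; congr (_ / _).
  by rewrite mulrC mulKf // pnatr_eq0.
have [max_w min_w] := (jumps_max_iota perm_w, jumps_min_rev_iota perm_w).
rewrite def_p def_lower def_upper !ler_pM2r // !ler_nat; split.
- by case: min_w => [-> | /ltnW].
- by case: max_w => [-> | /ltnW].
- rewrite subseq_deckE // map_val_all_but_last_card -/w.
  split=> [/D_inj/(mulrIn (oner_neq0 R)) eq_j | -> //].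
  by case: max_w => //; rewrite eq_j ltnn.
- rewrite subseq_deckE => [|x]; last exact: mem_rev.
  rewrite map_rev map_val_all_but_last_card -/w.
  split=> [/D_inj/(mulrIn (oner_neq0 R)) eq_j | -> //].
  by case: min_w => //; rewrite eq_j ltnn.
Qed.
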